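(* Let $\alpha<1$ and let $l=l(r)$ be positive integers such that $l/r\to\alpha$ as $r\to\infty$. For the ensemble of regular $(l,r)$-LDPC codes (of rate $1-l/r$), with $\varepsilon^*(l,r)$ denoting the coupled-system threshold, i.e. the maximal $\varepsilon\in[0,1]$ such that $$U(x,\varepsilon)=\frac1r-\frac{(1-x)^r}{r}-x(1-x)^{r-1}-\frac{\varepsilon}{l}\left[1-(1-x)^{r-1}\right]^{l}\ \ge\ 0\quad\text{for all }x\in[0,1],$$ one has $$\lim_{r\to\infty}\varepsilon^*(l,r)=\alpha.$$
   Context: For the regular $(l,r)$-LDPC ensemble (variable-node degree $l$, check-node degree $r$) on the binary erasure channel with erasure probability $\varepsilon$, the single-system density evolution is $x^{(t+1)}=\varepsilon f(g(x^{(t)}))$ with $g(x)=1-(1-x)^{r-1}$ and $f(y)=y^{l-1}$. The associated one-dimensional potential (Lyapunov) function is $U(x,\varepsilon)=\int_0^x g'(z)\,[z-\varepsilon f(g(z))]\,dz$, which for this ensemble equals the closed form given in the claim. The coupled-system threshold $\varepsilon^*(l,r)$ is by definition the maximal $\varepsilon\in[0,1]$ for which $U(x,\varepsilon)\ge0$ for all $x\in[0,1]$. *)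

(* Defs.v *)
(* Stdlib reals and Coquelicot. *)
From Stdlib Require Import Reals ClassicalEpsilon.
From Coquelicot Require Import Coquelicot.
Local Open Scope R_scope.

(* The density evolution of the regular (l,r) ensemble on the BEC(eps) is
   x |-> eps * f (g x), with f := var_node l and g := check_node r.
   The truncated subtractions are meant for l, r >= 1. *)
Definition var_node (l : nat) (y : R) : R := y ^ (l - 1).

Definition check_node (r : nat) (x : R) : R := 1 - (1 - x) ^ (r - 1).

Definition potential (f g : R -> R) (x eps : R) : R :=
  RInt (fun z => Derive g z * (z - eps * f (g z))) 0 x.

Definition ldpc_potential (l r : nat) (x eps : R) : R :=
  potential (var_node l) (check_node r) x eps.

Definition potential_nonneg (l r : nat) (eps : R) : Prop :=
  0 <= eps <= 1 /\ (forall x, 0 <= x <= 1 -> 0 <= ldpc_potential l r x eps).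

Definition is_maximum (E : R -> Prop) (m : R) : Prop :=
  E m /\ (forall e, E e -> e <= m).

(* "The" maximum, by description: the value is unspecified when there is no
   maximum, so any result about it has to establish that one exists. *)
Definition coupled_threshold (l r : nat) : R :=
  epsilon (inhabits 0) (is_maximum (potential_nonneg l r)).

(* Main.v *)
(* At x = 1 the potential equals 1/r - eps/l, so the threshold is at most l/r.
   Conversely put n = r-1, y = (1-x)^n and L = 1 - (1+nx)y, so that
   r U = L - (eps r/l)(1-y)^l.  If eps < alpha then eps r/l <= c < 1 for large r.
   Where y is at most a fixed delta, y(1+nx)^2 <= 4 gives L >= 1 - 2 sqrt(delta) >= c;
   where y > delta, L >= (1-y)^2/2, which beats (1-y)^l because
   (1-delta)^(l-2) tends to 0. *)
Require Import Defs.
From Stdlib Require Import Reals Lra Lia ClassicalEpsilon.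
From Coquelicot Require Import Coquelicot.
Local Open Scope R_scope.

(** * Closed form of the potential *)

Definition potential_closed_form (l r : nat) (x eps : R) : R :=
  1 / INR r - (1 - x) ^ r / INR r - x * (1 - x) ^ (r - 1)
  - eps / INR l * (1 - (1 - x) ^ (r - 1)) ^ l.

Lemma is_derive_check_node (r : nat) (x : R) :
  is_derive (check_node r) x (INR (r - 1) * (1 - x) ^ pred (r - 1)).
Proof.
unfold check_node; auto_derive; [easy|].
fold (1 - x). generalize ((1 - x) ^ pred (r - 1)). intros p. ring.
Qed.

Lemma is_derive_potential_closed_form (l r : nat) (x eps : R) :
  (0 < l)%nat -> (0 < r)%nat ->
  is_derive (fun z => potential_closed_form l r z eps) x
    (INR (r - 1) * (1 - x) ^ pred (r - 1)
     * (x - eps * var_node l (check_node r x))).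
Proof.
intros Hl Hr.
destruct l as [|m]; [lia|]; destruct r as [|n]; [lia|].
unfold potential_closed_form, var_node, check_node.
replace (S n - 1)%nat with n by lia; replace (S m - 1)%nat with m by lia.
assert (Hn : INR (S n) <> 0) by (apply not_0_INR; lia).
assert (Hm : INR (S m) <> 0) by (apply not_0_INR; lia).
evar_last.
- apply @is_derive_minus; [apply @is_derive_minus; [apply @is_derive_minus|]|].
  + apply @is_derive_const.
  + instantiate (1 := - (1 - x) ^ n).
    auto_derive; [easy|]. fold (1 - x). change (pred (S n)) with n.
    change (match n with 0%nat => 1 | S _ => INR n + 1 end) with (INR (S n)).
    field. exact Hn.
  + instantiate (1 := (1 - x) ^ n - x * (INR n * (1 - x) ^ pred n)).
    auto_derive; [easy|]. fold (1 - x). generalize ((1 - x) ^ pred n). intros p. ring.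
  + instantiate (1 := eps * (1 - (1 - x) ^ n) ^ m * (INR n * (1 - x) ^ pred n)).
    auto_derive; [easy|]. fold (1 - x). fold (1 - (1 - x) ^ n).
    change (pred (S m)) with m.
    change (match m with 0%nat => 1 | S _ => INR m + 1 end) with (INR (S m)).
    generalize ((1 - x) ^ pred n). intros p. field. exact Hm.
(* The two copies of [(1 - x) ^ n] cancel, which leaves the expanded integrand. *)
- unfold minus, plus, opp, zero; simpl. ring.
Qed.

Lemma ldpc_potentialE (l r : nat) (x eps : R) :
  (0 < l)%nat -> (0 < r)%nat ->
  ldpc_potential l r x eps = potential_closed_form l r x eps.
Proof.
intros Hl Hr.
unfold ldpc_potential, potential.
rewrite (RInt_ext _ (fun z => INR (r - 1) * (1 - z) ^ pred (r - 1)
     * (z - eps * var_node l (check_node r z)))); cycle 1.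
{ intros z _. now rewrite (is_derive_unique _ _ _ (is_derive_check_node r z)). }
erewrite is_RInt_unique; cycle 1.
{ apply (is_RInt_derive (fun z => potential_closed_form l r z eps)); intros z _.
  - now apply is_derive_potential_closed_form.
  - apply (ex_derive_continuous (V := R_NormedModule)).
    unfold var_node, check_node. auto_derive. easy. }
(* The antiderivative vanishes at the lower endpoint; [0 < l] enters through [0 ^ l = 0]. *)
assert (H0 : potential_closed_form l r 0 eps = 0).
{ unfold potential_closed_form.
  rewrite Rminus_0_r, !pow1, (Rminus_diag 1), pow_i by easy. unfold Rdiv; ring. }
rewrite H0. unfold minus, plus, opp; simpl. ring.
Qed.

(** Factor out [(1 - x) ^ n] and use [(1 - x) + (n + 1) * x = 1 + n * x]. *)
Lemma potential_closed_formE (l n : nat) (x eps : R) : (0 < l)%nat ->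
  potential_closed_form l (S n) x eps =
  (1 - (1 + INR n * x) * (1 - x) ^ n
   - eps * (INR (S n) / INR l) * (1 - (1 - x) ^ n) ^ l) / INR (S n).
Proof.
intros Hl; unfold potential_closed_form.
replace (S n - 1)%nat with n by lia.
assert (INR l <> 0) by (apply not_0_INR; lia).
assert (0 <= INR n) by apply pos_INR.
rewrite S_INR, <- tech_pow_Rmult. field. split; [easy | lra].
Qed.

(** * Elementary inequalities for powers of 1 - x *)

Lemma pow_unit_interval (u : R) (n : nat) : 0 <= u <= 1 -> 0 <= u ^ n <= 1.
Proof.
intros Hu; split; [now apply pow_le|].
rewrite <- (pow1 n). now apply pow_incr.
Qed.

(** With [y = (1 - x) ^ n], the terms linear in [y] cancel and [2 * n * x * y + y ^ 2 <= 1] remains.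
    For [y = exp (- s)] one has [n * x <= s], so this is a form of [s <= sinh s]; induction on [n]
    avoids the logarithm. *)
Lemma half_sqr_le_1_sub_tangent (n : nat) (x : R) : 0 <= x <= 1 ->
  (1 - (1 - x) ^ n) ^ 2 / 2 <= 1 - (1 + INR n * x) * (1 - x) ^ n.
Proof.
intros Hx.
enough (H : 2 * (INR n * x) * (1 - x) ^ n + ((1 - x) ^ n) ^ 2 <= 1) by lra.
induction n as [|n IH]; [simpl; lra|].
rewrite S_INR, <- tech_pow_Rmult.
pose proof (pow_unit_interval (1 - x) n ltac:(lra)) as Hy.
set (y := (1 - x) ^ n) in *.
assert (H1 : (1 - x) * (2 * (INR n * x) * y + y ^ 2) <= (1 - x) * 1)
  by (apply Rmult_le_compat_l; lra).
(* Exactly the slack left once [H1] is used: [1 - (1 - x) * (2 * y - y ^ 2) = (1 - x) * (1 - y) ^ 2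
   + x]. *)
assert (H2 : 0 <= x * ((1 - x) * (1 - y) ^ 2 + x)).
{ apply Rmult_le_pos; [lra|]. apply Rplus_le_le_0_compat; [|lra].
  apply Rmult_le_pos; [lra | apply pow2_ge_0]. }
nra.
Qed.

(** The product [(1 - x) ^ n * (1 + x) ^ n] is at most 1, and the terms of [(1 + x) ^ n] up to
    degree two already reach a quarter of [(1 + n * x) ^ 2]. *)
Lemma pow_mul_sqr_le_4 (n : nat) (x : R) : 0 <= x <= 1 ->
  (1 - x) ^ n * (1 + INR n * x) ^ 2 <= 4.
Proof.
intros Hx.
pose proof (pow_unit_interval (1 - x) n ltac:(lra)) as Hy.
assert (H : (1 - x) ^ n * (1 + INR n * x + INR n * (INR n - 1) / 2 * x ^ 2) <= 1).
{ clear Hy; induction n as [|n IH]; [simpl; lra|].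
  eapply Rle_trans; [|exact IH].
  rewrite S_INR, <- tech_pow_Rmult.
  pose proof (pow_unit_interval (1 - x) n ltac:(lra)) as Hy.
  pose proof (pos_INR n) as Hn.
  rewrite (Rmult_comm (1 - x)), Rmult_assoc.
  apply Rmult_le_compat_l; [lra|].
  (* Passing from [n] to [n + 1] lowers the second factor's bound by
     [x ^ 2 + n * (n + 1) / 2 * x ^ 3]. *)
  assert (0 <= x ^ 2) by apply pow2_ge_0.
  assert (0 <= INR n * (INR n + 1) * x ^ 3)
    by (apply Rmult_le_pos; [nra | apply pow_le; lra]).
  nra. }
assert (Hnx : 0 <= INR n * x * (1 - x)).
{ apply Rmult_le_pos; [apply Rmult_le_pos; [apply pos_INR | lra] | lra]. }
assert (0 <= INR n * x) by (apply Rmult_le_pos; [apply pos_INR | lra]).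
(* The difference of the two sides is [3 + (n * x) ^ 2 + 2 * n * x * (1 - x)]. *)
assert (H2 : (1 + INR n * x) ^ 2
             <= 4 * (1 + INR n * x + INR n * (INR n - 1) / 2 * x ^ 2)) by nra.
apply Rle_trans with
  ((1 - x) ^ n * (4 * (1 + INR n * x + INR n * (INR n - 1) / 2 * x ^ 2))); [|lra].
now apply Rmult_le_compat_l.
Qed.

(** * Existence of the threshold *)

Lemma potential_nonnegP (l n : nat) (eps : R) : (0 < l)%nat ->
  potential_nonneg l (S n) eps <->
  0 <= eps <= 1 /\
  forall x, 0 <= x <= 1 ->
    eps * (INR (S n) / INR l) * (1 - (1 - x) ^ n) ^ l
    <= 1 - (1 + INR n * x) * (1 - x) ^ n.
Proof.
intros Hl; unfold potential_nonneg.
assert (Hr : 0 < INR (S n)) by (apply lt_0_INR; lia).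
split; intros [He H]; (split; [exact He|]); intros x Hx; specialize (H x Hx).
- rewrite ldpc_potentialE in H by lia.
  rewrite potential_closed_formE in H by easy.
  apply (Rmult_le_compat_r (INR (S n))) in H; [|lra].
  unfold Rdiv at 1 in H.
  rewrite Rmult_0_l, Rmult_assoc, Rinv_l in H by lra. lra.
- rewrite ldpc_potentialE by lia.
  rewrite potential_closed_formE by easy.
  apply Rdiv_le_0_compat; lra.
Qed.

(** The admissible set contains 0 and is bounded by 1. Its supremum is attained because each [x]
    imposes a non-strict constraint linear in [eps]. *)
Lemma coupled_threshold_is_maximum (l r : nat) : (0 < l)%nat -> (0 < r)%nat ->
  is_maximum (potential_nonneg l r) (coupled_threshold l r).
Proof.
intros Hl Hr. unfold coupled_threshold. apply epsilon_spec.
destruct r as [|n]; [lia|].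
assert (Hc : 0 < INR (S n) / INR l)
  by (apply Rdiv_lt_0_compat; apply lt_0_INR; lia).
assert (H0 : potential_nonneg l (S n) 0).
{ apply potential_nonnegP; [easy|]. split; [lra|]. intros x Hx.
  pose proof (half_sqr_le_1_sub_tangent n x Hx).
  pose proof (pow2_ge_0 (1 - (1 - x) ^ n)). lra. }
destruct (completeness (potential_nonneg l (S n))) as [m [Hub Hlub]].
{ exists 1. now intros e [He _]. }
{ now exists 0. }
exists m. split; [|exact Hub].
apply potential_nonnegP; [easy|]. split.
{ split; [now apply Hub | apply Hlub; now intros e [He _]]. }
intros x Hx.
pose proof (pow_unit_interval (1 - x) n ltac:(lra)) as Hy.
assert (HB : 0 <= INR (S n) / INR l * (1 - (1 - x) ^ n) ^ l)
  by (apply Rmult_le_pos; [lra | apply pow_le; lra]).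
rewrite Rmult_assoc.
set (B := INR (S n) / INR l * (1 - (1 - x) ^ n) ^ l) in *.
assert (HA : forall e, potential_nonneg l (S n) e ->
               e * B <= 1 - (1 + INR n * x) * (1 - x) ^ n).
{ intros e He. apply potential_nonnegP in He; [|easy].
  unfold B. rewrite <- Rmult_assoc. now apply He. }
(* If [B > 0], the constraint is an upper bound on [eps], inherited by the supremum; if [B = 0], it
   does not involve [eps] and is read off at 0. *)
destruct HB as [HB|HB].
- apply Rle_div_r; [exact HB|]. apply Hlub. intros e He.
  apply Rle_div_r; [exact HB|]. now apply HA.
- rewrite <- HB, Rmult_0_r. specialize (HA 0 H0). lra.
Qed.

(** * Upper and lower bounds, and the limit *)

Lemma coupled_threshold_le_ratio (l r : nat) : (0 < l)%nat -> (1 < r)%nat ->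
  coupled_threshold l r <= INR l / INR r.
Proof.
intros Hl Hr.
destruct (coupled_threshold_is_maximum l r Hl ltac:(lia)) as [H _].
destruct r as [|n]; [lia|].
apply potential_nonnegP in H; [|easy]. destruct H as [_ H].
specialize (H 1 ltac:(lra)).
(* Since [1 < r], the exponent [n] is positive and [0 ^ n = 0]. *)
rewrite Rminus_diag, pow_i, Rminus_0_r, pow1 in H by lia.
assert (0 < INR (S n)) by (apply lt_0_INR; lia).
assert (0 < INR l) by (apply lt_0_INR; lia).
apply Rle_div_r; [easy|].
apply (Rmult_le_compat_r (INR l)) in H; [|lra].
replace (coupled_threshold l (S n) * (INR (S n) / INR l) * 1 * INR l)
  with (coupled_threshold l (S n) * INR (S n)) in H by (field; lra).
lra.
Qed.

(** [beta] stands for an eventual lower bound of [l / r]; [N] depends only on [eps] and [beta], so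
    it serves every [l] along the sequence. *)
Lemma potential_nonneg_of_lt_ratio (eps beta : R) :
  0 <= eps <= 1 -> eps < beta ->
  exists N : nat, forall l r : nat, (0 < l)%nat -> (N <= r)%nat ->
    beta * INR r <= INR l -> potential_nonneg l r eps.
Proof.
intros He Hb.
set (c := eps / beta).
assert (Hc : 0 <= c < 1).
{ unfold c; split; [apply Rdiv_le_0_compat; lra|]. apply Rlt_div_l; lra. }
(* Chosen so that [4 * d = (1 - c) ^ 2], which bounds the square of [(1 + n * x) * y] when
   [y <= d]. *)
set (d := ((1 - c) / 2) ^ 2).
assert (Hd : 0 < d < 1) by (unfold d; nra).
destruct (pow_lt_1_zero (1 - d) ltac:(rewrite Rabs_pos_eq; lra) (1 / 2) ltac:(lra))
  as [M HM].
(* This forces [l >= beta * r >= M + 2]: two factors of [(1 - y) ^ l] are kept to match the square,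
   and the other [l - 2] absorb the factor 1/2. *)
destruct (INR_unbounded ((INR M + 2) / beta)) as [N HN].
exists (S N). intros l [|n] Hl Hr Hlr; [lia|].
assert (Hl2 : (M + 2 <= l)%nat).
{ apply INR_le. rewrite plus_INR. simpl (INR 2).
  apply Rlt_div_l in HN; [|lra].
  assert (INR N <= INR (S n)) by (apply le_INR; lia). nra. }
assert (Hl0 : 0 < INR l) by (apply lt_0_INR; lia).
assert (Hr0 : 0 < INR (S n)) by (apply lt_0_INR; lia).
apply potential_nonnegP; [easy|]. split; [exact He|]. intros x Hx.
pose proof (pow_unit_interval (1 - x) n ltac:(lra)) as Hy.
pose proof (half_sqr_le_1_sub_tangent n x Hx) as HL.
pose proof (pow_mul_sqr_le_4 n x Hx) as H4.
assert (0 <= INR n * x) by (apply Rmult_le_pos; [apply pos_INR | lra]).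
set (y := (1 - x) ^ n) in *.
pose proof (pow_unit_interval (1 - y) l ltac:(lra)) as Hyl.
assert (Hk : eps * (INR (S n) / INR l) <= c).
{ unfold c, Rdiv. apply Rmult_le_compat_l; [lra|].
  apply Rle_div_l; [easy|]. rewrite Rmult_comm. apply Rle_div_r; lra. }
apply Rle_trans with (c * (1 - y) ^ l); [apply Rmult_le_compat_r; lra|].
destruct (Rle_lt_dec y d) as [Hyd|Hyd].
- assert (Hs : (1 + INR n * x) * y <= 1 - c).
  { apply Rsqr_incr_0_var; [unfold Rsqr | lra].
    assert (H5 : y * (y * (1 + INR n * x) ^ 2) <= d * 4)
      by (apply Rmult_le_compat; try lra; apply Rmult_le_pos; [lra | apply pow2_ge_0]).
    unfold d in H5. nra. }
  nra.
- apply Rle_trans with ((1 - y) ^ l); [nra|].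
  replace l with ((l - 2) + 2)%nat by lia. rewrite pow_add.
  assert (H6 : (1 - y) ^ (l - 2) <= 1 / 2).
  { apply Rle_trans with ((1 - d) ^ (l - 2)); [apply pow_incr; lra|].
    specialize (HM (l - 2)%nat ltac:(lia)).
    apply Rabs_def2 in HM. lra. }
  pose proof (pow2_ge_0 (1 - y)). nra.
Qed.

Theorem proposition2 (alpha : R) (l : nat -> nat)
  (halpha : alpha < 1)
  (hl : forall r : nat, (0 < r)%nat -> (0 < l r)%nat)
  (hlim : is_lim_seq (fun r : nat => INR (l r) / INR r) alpha) :
  (forall (r : nat) (x eps : R),
     (0 < r)%nat -> 0 <= x <= 1 -> 0 <= eps <= 1 ->
     ldpc_potential (l r) r x eps =
       1 / INR r - (1 - x) ^ r / INR r - x * (1 - x) ^ (r - 1)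
       - eps / INR (l r) * (1 - (1 - x) ^ (r - 1)) ^ (l r)) /\
  is_lim_seq (fun r : nat => coupled_threshold (l r) r) alpha.
Proof.
split.
{ intros r x eps Hr _ _. now apply ldpc_potentialE; [apply hl|]. }
apply is_lim_seq_spec. apply is_lim_seq_spec in hlim. intros e.
pose proof (cond_pos e) as He.
assert (Hlow : exists N : nat, forall r, (N <= r)%nat ->
                 alpha - e < coupled_threshold (l r) r).
(* A negative target lies below the threshold trivially; this also covers [alpha <= 0]. *)
{ destruct (Rlt_le_dec (alpha - e) 0) as [Hneg|Hpos].
  - exists 1%nat. intros r Hr.
    destruct (coupled_threshold_is_maximum (l r) r (hl r Hr) Hr) as [[H _] _]. lra.
  (* The test value [alpha - e / 2] lies in [0,1] because [alpha < 1], and [l r / r] eventually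
     exceeds [alpha - e / 4]. *)
  - destruct (potential_nonneg_of_lt_ratio (alpha - e / 2) (alpha - e / 4))
      as [N1 HN1]; [lra | lra |].
    destruct (hlim (mkposreal (e / 4) ltac:(lra))) as [N2 HN2].
    exists (S (N1 + N2)). intros r Hr.
    specialize (HN2 r ltac:(lia)). simpl in HN2. apply Rabs_def2 in HN2.
    destruct (coupled_threshold_is_maximum (l r) r (hl r ltac:(lia)) ltac:(lia))
      as [_ Hmax].
    apply Rlt_le_trans with (alpha - e / 2); [lra|].
    apply Hmax, HN1; [apply hl; lia | lia |].
    apply Rle_div_r; [apply lt_0_INR; lia | lra]. }
destruct Hlow as [N1 HN1]. destruct (hlim e) as [N2 HN2].
exists (2 + N1 + N2)%nat. intros r Hr.
specialize (HN1 r ltac:(lia)). specialize (HN2 r ltac:(lia)).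
apply Rabs_def2 in HN2.
pose proof (coupled_threshold_le_ratio (l r) r (hl r ltac:(lia)) ltac:(lia)).
apply Rabs_def1; lra.
Qed.
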